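(* Let $d\ge1$ be an integer. The sets $$X_1:=\{(A,p)\in\mathbf{F}_U(\mathbb{R}^d)\times[0,d] : \dim_{\mathcal H}(A)>p\},\qquad X_2:=\{(A,p)\in\mathbf{F}_U(\mathbb{R}^d)\times[0,d] : \dim_{\mathcal H}(A)\ge p\}$$ are $\boldsymbol\Sigma^0_2$ and $\boldsymbol\Pi^0_3$ respectively. In particular, for every $p\in[0,d)$ and $q\in(0,d]$, the sets $$\{A\in\mathbf{F}(\mathbb{R}^d) : \dim_{\mathcal H}(A)>p\},\qquad \{A\in\mathbf{F}(\mathbb{R}^d) : \dim_{\mathcal H}(A)\ge q\}$$ are $\boldsymbol\Sigma^0_2$-complete and $\boldsymbol\Pi^0_3$-complete respectively.
   Context: $\mathbf{F}(\mathbb{R}^d)$ is the set of closed subsets of $\mathbb{R}^d$ (including $\emptyset$) with the Fell topology, generated by the sets $\{F:F\cap K=\emptyset\}$ ($K\subset\mathbb{R}^d$ compact) and $\{F:F\cap U\ne\emptyset\}$ ($U\subset\mathbb{R}^d$ open); it is Polish. $\mathbf{F}_U(\mathbb{R}^d)$ is the same set with the upper Fell topology, generated only by the sets $\{F:F\cap K=\emptyset\}$, $K$ compact. Products carry the product topology. For $A\subset\mathbb{R}^d$, the Hausdorff dimension is $\dim_{\mathcal H}(A)=\sup\{s\ge 0:\mathcal H^s(A)>0\}$, with $\sup\emptyset=0$, where $\mathcal H^s$ is $s$-dimensional Hausdorff measure. Borel hierarchy (used verbatim in any topological space): $\boldsymbol\Sigma^0_1$ are the open sets, $\boldsymbol\Pi^0_1$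 the closed sets; $\boldsymbol\Sigma^0_\xi$ sets ($\xi>1$) are countable unions of sets each in some $\boldsymbol\Pi^0_{\eta}$ with $\eta<\xi$; $\boldsymbol\Pi^0_\xi$ sets are complements of $\boldsymbol\Sigma^0_\xi$ sets. For $A\subset X$, $B\subset Y$ write $A\le_W B$ if there is a continuous $f:X\to Y$ with $x\in A\iff f(x)\in B$. For $Y$ Polish, $B\subset Y$ is $\boldsymbol\Gamma$-hard if $A\le_W B$ for every $A\in\boldsymbol\Gamma(X)$ and every Polish $X$ having a basis of clopen sets; it is $\boldsymbol\Gamma$-complete if it is $\boldsymbol\Gamma$-hard and $B\in\boldsymbol\Gamma(Y)$. *)

(* Defs.v *)
From HB Require Import structures.
From mathcomp Require Import all_boot all_order all_algebra.
From mathcomp Require Import all_classical all_reals all_analysis.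

Set Implicit Arguments.
Unset Strict Implicit.
Unset Printing Implicit Defensive.

Import Order.TTheory GRing.Theory Num.Theory.
Import numFieldNormedType.Exports.

Local Open Scope classical_set_scope.
Local Open Scope ring_scope.

Record closedSet (T : topologicalType) := ClosedSet {
  carrier :> set T;
  carrier_closed : closed carrier }.

HB.instance Definition _ (T : topologicalType) := gen_eqMixin (closedSet T).
HB.instance Definition _ (T : topologicalType) := gen_choiceMixin (closedSet T).

Section fell_topologies.
Variable T : topologicalType.

Definition miss (K : set T) : set (closedSet T) :=
  [set F : closedSet T | F `&` K = set0].

Definition hit (U : set T) : set (closedSet T) :=
  [set F : closedSet T | F `&` U !=set0].

(* Two copies of the same carrier, each with its own topology. *)
Definition fell : Type := closedSet T.
Definition upper_fell : Type := closedSet T.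

HB.instance Definition _ := Choice.on fell.
HB.instance Definition _ := Choice.on upper_fell.

HB.instance Definition _ := @isSubBaseTopological.Build fell
  (set (closedSet T)) ((miss @` compact) `|` (hit @` open)) id.

HB.instance Definition _ := @isSubBaseTopological.Build upper_fell
  (set (closedSet T)) (miss @` compact) id.

End fell_topologies.

Section hausdorff_dimension.
Variables (R : realType) (d : nat).
Implicit Types (A U : set 'rV[R]_d) (x y : 'rV[R]_d) (s delta : R).

(* The library's norm on row vectors is the sup norm; it induces the same
   topology, but diameters are taken in the Euclidean metric. *)
Definition edist x y : R := Num.sqrt (\sum_(i < d) (x 0 i - y 0 i) ^+ 2).

(* Equal to -oo on the empty set. *)
Definition diam A : \bar R :=
  ereal_sup [set (edist xy.1 xy.2)%:E | xy in A `*` A].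

(* The empty set contributes 0, also for s = 0; a singleton contributes
   0 `^ 0 = 1 for s = 0, so that the 0-dimensional measure counts points. *)
Definition diam_pow s U : \bar R :=
  if U == set0 then 0%E else poweR (diam U) s.

Definition hausdorff_premeasure s delta A : \bar R :=
  ereal_inf [set (\sum_(0 <= i <oo) diam_pow s (U i))%E
            | U in [set U : nat -> set 'rV[R]_d |
                A `<=` \bigcup_i U i /\ forall i, (diam (U i) <= delta%:E)%E]].

Definition hausdorff_measure s A : \bar R :=
  ereal_sup [set hausdorff_premeasure s delta A
            | delta in [set delta : R | 0 < delta]].

(* The supremum is taken in [0, +oo], whence the maximum with 0. *)
Definition hausdorff_dim A : \bar R :=
  maxe 0%E (ereal_sup [set s%:E
    | s in [set s : R | 0 <= s /\ (0 < hausdorff_measure s A)%E]]).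

End hausdorff_dimension.

(* Finite levels of the Borel hierarchy; the lowest level is 1.  The level
   [m i] may vary with [i]: outside metrizable spaces, open sets need not be
   countable unions of closed sets, so the levels need not be increasing. *)
Inductive Sigma0 (T : topologicalType) : nat -> set T -> Prop :=
| Sigma0_open S : open S -> Sigma0 1%N S
| Sigma0_bigcup n S (F : nat -> set T) (m : nat -> nat) :
    (1 < n)%N -> (forall i, 0 < m i < n)%N ->
    (forall i, Sigma0 (m i) (~` F i)) -> S = \bigcup_i F i -> Sigma0 n S.

Definition Pi0 (n : nat) (T : topologicalType) (S : set T) : Prop :=
  Sigma0 n (~` S).

Definition wadge_le (X Y : topologicalType) (A : set X) (B : set Y) : Prop :=
  exists2 f : X -> Y, continuous f & forall x, A x <-> B (f x).

Definition is_metric (R : realType) (X : Type) (dist : X -> X -> R) : Prop :=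
  [/\ forall x y, dist x y = 0 <-> x = y,
      forall x y, dist x y = dist y x &
      forall x y z, dist x z <= dist x y + dist y z].

Definition polish (R : realType) (X : topologicalType) : Prop :=
  (exists2 D : set X, countable D & dense D) /\
  exists dist : X -> X -> R,
    [/\ is_metric dist,
        forall x, nbhs x =
          filter_from [set e : R | 0 < e] (fun e => [set y | dist x y < e]) &
        forall u : nat -> X,
          (forall e : R, 0 < e -> exists N, forall m n,
             (N <= m)%N -> (N <= n)%N -> dist (u m) (u n) < e) ->
          exists x : X, u @ \oo --> x].

(* The library's [zero_dimensional] is only total separation, which is weaker
   than having a basis of clopen sets. *)
Definition clopen_basis (X : topologicalType) : Prop :=
  exists2 B : set (set X), B `<=` clopen & basis B.

Section hardness.
Variables (R : realType) (Gamma : forall T : topologicalType, set T -> Prop).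
Variables (Y : topologicalType) (B : set Y).

Definition hard : Prop :=
  forall X : topologicalType, polish R X -> clopen_basis X ->
  forall A : set X, Gamma A -> wadge_le A B.

Definition complete_for : Prop := hard /\ Gamma B.

End hardness.

(* Main.v *)
Require Import Defs.
From mathcomp Require Import all_boot all_order all_algebra.
From mathcomp Require Import all_classical all_reals all_analysis.
From mathcomp Require Import ring lra.

Set Implicit Arguments.
Unset Strict Implicit.
Unset Printing Implicit Defensive.

Import Order.TTheory GRing.Theory Num.Theory.
Import numFieldNormedType.Exports.

Local Open Scope classical_set_scope.
Local Open Scope ring_scope.

(** Everything is read off the sets whose s-dimensional Hausdorff measure
    vanishes. For [s > 0] this means that the set has, for every [eps], a cover
    by countably many sup-norm balls with [\sum r_i `^ s <= eps]
    ([hausdorff_measure_hnull], [hnull_hausdorff_measure]): the restriction on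
    the size of the covering sets disappears, because a small sum forces small
    radii, and the Euclidean diameters are replaced by radii, which changes the
    sums by bounded factors only. Hence, for [p >= 0], [dim A > p] iff [A] is
    not [s]-null for some [s > p] ([hausdorff_dim_gtP]).

    Upper bounds. The balls are open, so if they cover [A] inside a compact cube
    [K] then [A] misses the compact set [K] minus the balls, and so does every
    set of an upper Fell neighbourhood of [A]. The sets having such a cover with
    sum at most [1 / m] thus form an open set ([open_cover_near]), and [A] is
    null iff it lies in these open sets for all cubes and all [m]. Not being
    null is therefore a countable union of closed conditions, and letting [s]
    run through the rationals gives Sigma_2 for [dim A > p]. The condition
    [dim A >= p] fails iff [dim A <= a < p] for some rational [a], which is a
    countable union of complements of Sigma_2 sets.

    Hardness. For [0 < s < d] there is a compact Cantor dust that is not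
    [s]-null but is [u]-null for all [u > s] ([cantor_dust]): spread the binary
    digits of [t] in [0, 1[ over the [d] coordinates and read them in the ratio
    [b] with [b `^ s = 2 ^- d]. Then [t] is an [s]-Hoelder function of its image,
    so that a cover of the dust with a small sum would give a cover of [0, 1[ by
    intervals of small total length. Now let [F n] be closed subsets of a
    zero-dimensional Polish space [X] and exhaust each open set [~` F n] by an
    increasing sequence of clopen sets [C n k]. Send [x] to the closure of all
    points [g n k] with [x] not in [C n k], where [g n] enumerates a dense
    subset of the [n]-th dust. The [n]-th piece is the whole dust if [x] is in
    [F n], and finite otherwise. As the dusts are pushed off to infinity, the
    pieces do not interact, the map is continuous for the Fell topology, and the
    image of [x] has dimension [> a] iff [x] lies in some [F n] whose dust has
    dimension [> a] ([dim_reduction]). With a constant dimension in ]p, d[ this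
    reduces [\bigcup_n F n]. For a Pi_3 set [\bigcap_i \bigcup_k G i k], use one
    dust for every finite sequence [w], attached to the closed set
    [\bigcap_(i < size w) G i w_i], of dimension close to [q] when [w] is long:
    the image of [x] has dimension at least [q] iff [x] admits arbitrarily long
    sequences [w]. *)

(** * Sets of null Hausdorff measure *)

Section null_sets.
Variables (R : realType) (d : nat).
Implicit Types (A B : set 'rV[R]_d) (s t eps : R).

Lemma rV_ballP (x y : 'rV[R]_d) (e : R) :
  ball x e y <-> 0 < e /\ forall j, `|x 0 j - y 0 j| < e.
Proof.
split=> [[e0 xy]|[e0 xy]]; split=> //; first by move=> j; exact: xy.
by move=> i j; rewrite ord1; exact: xy.
Qed.

(** Bounding all partial sums keeps the computations in [R]; null radii stand
    for empty balls, so finite covers are included. *)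
Definition small_cover s eps A := exists (x : nat -> 'rV[R]_d) (r : nat -> R),
  [/\ forall i, 0 <= r i, A `<=` \bigcup_i ball (x i) (r i) &
      forall n, \sum_(0 <= i < n) r i `^ s <= eps].

(** For [s > 0], these are the sets of null s-dimensional Hausdorff measure, as
    shown by [hausdorff_measure_hnull] and [hnull_hausdorff_measure]. *)
Definition hnull s A := forall eps, 0 < eps -> small_cover s eps A.

Lemma hnullS s A B : A `<=` B -> hnull s B -> hnull s A.
Proof.
move=> AB nB eps /nB[x [r [r0 Br sr]]]; exists x, r; split => //.
exact: subset_trans Br.
Qed.

(** A sum at most 1 forces all radii to be at most 1, and then raising the
    exponent decreases each term. *)
Lemma hnull_le s t A : 0 < s -> s <= t -> hnull s A -> hnull t A.
Proof.
move=> s0 st nA eps eps0.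
have m0 : 0 < Num.min eps 1 by rewrite lt_min eps0 ltr01.
have [x [r [r0 Ar sr]]] := nA _ m0; exists x, r; split => // n.
rewrite (@le_trans _ _ (\sum_(0 <= i < n) r i `^ s))//; last first.
  by rewrite (le_trans (sr n))// ge_min lexx.
apply: ler_sum_nat => i _.
have [->|ri0] := eqVneq (r i) 0.
  by rewrite !powR0 ?gt_eqF// (lt_le_trans s0 st).
have rs1 : r i `^ s <= 1.
  have := sr i.+1; rewrite big_nat_recr//= => ss.
  have : 0 <= \sum_(0 <= i0 < i) r i0 `^ s by apply: sumr_ge0 => *; exact: powR_ge0.
  have : Num.min eps 1 <= 1 by rewrite ge_min lexx orbT.
  by lra.
have r1 : r i <= 1.
  rewrite leNgt; apply/negP => r1.
  have := gt0_ltr_powR s0 _ _ r1; rewrite powR1 !nnegrE ler01 r0 => /(_ isT isT).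
  by rewrite ltNge rs1.
have rts : r i `^ (t - s) <= 1.
  have -> : 1 = 1 `^ (t - s) :> R by rewrite powR1.
  by apply: ge0_ler_powR; rewrite ?nnegrE ?subr_ge0.
rewrite -(subrKC s t) powRD; last by rewrite ri0 implybT.
by rewrite ler_piMr// powR_ge0.
Qed.

Lemma half_sum (e : R) n : 0 < e -> \sum_(0 <= i < n) e / 2 ^+ i.+1 <= e.
Proof.
move=> e0.
suff -> : \sum_(0 <= i < n) e / 2 ^+ i.+1 = e - e / 2 ^+ n.
  by rewrite gerBl divr_ge0 ?ltW// exprn_gt0.
elim: n => [|n ih]; first by rewrite big_geq// expr0 divr1 subrr.
by rewrite big_nat_recr//= ih exprS invfM; lra.
Qed.

Lemma powR_root (a s : R) : 0 < s -> 0 <= a -> (a `^ s^-1) `^ s = a.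
Proof. by move=> s0 a0; rewrite -powRrM mulVf ?gt_eqF// powRr1. Qed.

Lemma ler_sum_uniq_sub (I : eqType) (s1 s2 : seq I) (F : I -> R) :
  uniq s1 -> uniq s2 -> {subset s1 <= s2} -> (forall i, i \in s2 -> 0 <= F i) ->
  \sum_(i <- s1) F i <= \sum_(i <- s2) F i.
Proof.
move=> u1 u2 s12 F0.
have s1E : perm_eq s1 [seq i <- s2 | i \in s1].
  apply: uniq_perm => //; first exact: filter_uniq.
  by move=> i; rewrite mem_filter; case: (boolP (i \in s1)) => // /s12 ->.
rewrite (perm_big _ s1E)/= big_filter [leRHS](bigID (mem s1))/= lerDl big_seq_cond.
by apply: sumr_ge0 => i /andP[/F0].
Qed.

(** Cover the [i]-th set up to [eps / 2 ^+ i.+1] and enumerate all the balls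
    along a bijection between [nat] and [nat * nat]. *)
Lemma hnull_bigcup s (A : nat -> set 'rV[R]_d) :
  (forall i, hnull s (A i)) -> hnull s (\bigcup_i A i).
Proof.
move=> nA eps eps0.
have ei i : 0 < eps / 2 ^+ i.+1 by rewrite divr_gt0// exprn_gt0.
have /choice[x /choice[r xr]] : forall i, exists x r,
  [/\ forall j, 0 <= r j, A i `<=` \bigcup_j ball (x j) (r j) &
      forall n, \sum_(0 <= j < n) r j `^ s <= eps / 2 ^+ i.+1].
  by move=> i; exact: nA.
have /card_esym/ppcard_eqP[f] := card_nat2.
exists (fun k => x (f k).1 (f k).2), (fun k => r (f k).1 (f k).2); split.
- by move=> k; have [+ _ _] := xr (f k).1; exact.
- move=> y [i _ Aiy]; have [_ + _] := xr i => /(_ y Aiy)[j _ yj].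
  by exists (f^-1%FUN (i, j)) => //; rewrite invK ?inE.
- move=> n; set N := (\max_(k < n) maxn (f k).1 (f k).2).+1.
  pose F (p : nat * nat) := r p.1 p.2 `^ s.
  pose square := [seq (i, j) | i <- index_iota 0 N, j <- index_iota 0 N].
  apply: (@le_trans _ _ (\sum_(p <- square) F p)).
    rewrite -[X in X <= _](big_map f xpredT F).
    apply: ler_sum_uniq_sub => [|||p _]; last exact: powR_ge0.
    + by rewrite map_inj_uniq ?iota_uniq//; exact: injT.
    + by rewrite allpairs_uniq ?iota_uniq// => -[? ?] [? ?].
    + move=> p /mapP[k]; rewrite mem_index_iota => /andP[_ kn] ->.
      have [k1 k2] : ((f k).1 < N /\ (f k).2 < N)%N.
        have := @leq_bigmax_cond _ xpredT
          (fun k : 'I_n => maxn (f k).1 (f k).2) (Ordinal kn) isT.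
        by rewrite geq_max => /andP[].
      apply/allpairsPdep; exists (f k).1, (f k).2.
      by rewrite !mem_index_iota -surjective_pairing.
  rewrite big_allpairs_dep/=.
  apply: (@le_trans _ _ (\sum_(0 <= i < N) eps / 2 ^+ i.+1)); last exact: half_sum.
  by apply: ler_sum => i _; have [_ _] := xr i; exact.
Qed.

Lemma hnull_finite_cover s A : 0 < s ->
  (forall eps, 0 < eps -> exists (n : nat) (x : nat -> 'rV[R]_d) (r : R),
    [/\ 0 <= r, A `<=` \bigcup_(k in `I_n) ball (x k) r & n%:R * r `^ s <= eps]) ->
  hnull s A.
Proof.
move=> s0 Ac eps /Ac[n [x [r [r0 Ax nr]]]].
exists x, (fun k => if (k < n)%N then r else 0); split.
- by move=> k; case: ifP.
- by move=> y /Ax[k /= kn yk]; exists k => //; rewrite kn.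
- move=> m; apply: le_trans nr.
  rewrite (@le_trans _ _ (\sum_(0 <= i < m | (i < n)%N) r `^ s))//.
    rewrite [leRHS]big_mkcond/=; apply: ler_sum => i _.
    by case: ifP => //; rewrite powR0 ?gt_eqF.
  rewrite big_nat_cond -big_filter big_const_seq count_predT iter_addr_0 mulr_natl.
  apply: ler_wpMn2l; first exact: powR_ge0.
  rewrite -[leqRHS](size_iota 0); apply: uniq_leq_size.
    by rewrite filter_uniq ?iota_uniq.
  by move=> k; rewrite mem_filter mem_iota => /andP[/andP[_ ->]].
Qed.

Lemma hnull_set1 s (x : 'rV[R]_d) : 0 < s -> hnull s [set x].
Proof.
move=> s0; apply: hnull_finite_cover => // eps eps0.
exists 1%N, (fun=> x), (eps `^ s^-1); split.
- exact: powR_ge0.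
- by move=> _ ->; exists 0%N => //; apply: ballxx; rewrite powR_gt0.
- by rewrite mul1r powR_root// ltW.
Qed.

Lemma hnull_countable s A : 0 < s -> countable A -> hnull s A.
Proof.
move=> s0 /pfcard_geP[->|/unsquash f].
  move=> eps eps0; exists (fun=> 0), (fun=> 0); split => // n.
  by rewrite powR0 ?gt_eqF// big1// ltW.
apply: (@hnullS _ _ (\bigcup_n [set f n])).
  by move=> y /(@surj _ _ _ _ f)[n _ <-]; exists n.
by apply: hnull_bigcup => i; exact: hnull_set1.
Qed.

End null_sets.

(** * Hausdorff measure and dimension *)

Section hausdorff.
Variables (R : realType) (d : nat).
Implicit Types (A U : set 'rV[R]_d) (x y : 'rV[R]_d) (s t r : R).

Lemma coord_le_edist x y j : `|x 0 j - y 0 j| <= Defs.edist x y.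
Proof.
rewrite -sqrtr_sqr ler_wsqrtr// (bigD1 j)//= lerDl.
by apply: sumr_ge0 => i _; exact: sqr_ge0.
Qed.

Lemma edist_le x y e : 0 <= e -> (forall j, `|x 0 j - y 0 j| <= e) ->
  Defs.edist x y <= d%:R * e.
Proof.
move=> e0 xy; have de0 : 0 <= d%:R * e by rewrite mulr_ge0.
rewrite -(ger0_norm de0) -sqrtr_sqr ler_wsqrtr//.
apply: (@le_trans _ _ (\sum_(i < d) e ^+ 2)).
  apply: ler_sum => i _; rewrite -real_normK ?num_real//.
  by rewrite lerXn2r ?nnegrE.
rewrite sumr_const card_ord exprMn -[leLHS]mulr_natl ler_wpM2r ?sqr_ge0//.
by rewrite -natrX ler_nat; case: (d) => // n; rewrite leq_pmulr.
Qed.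

Lemma edist_le_diam U x y : U x -> U y -> ((Defs.edist x y)%:E <= diam U)%E.
Proof. by move=> Ux Uy; apply: ereal_sup_ubound; exists (x, y). Qed.

Lemma diam_ge0 U x : U x -> (0 <= diam U)%E.
Proof.
by move=> Ux; apply: le_trans (edist_le_diam Ux Ux); rewrite lee_fin sqrtr_ge0.
Qed.

Lemma diam_pow_ge0 s U : (0 <= diam_pow s U)%E.
Proof. by rewrite /diam_pow; case: ifP => // _; exact: poweR_ge0. Qed.

Lemma diam_ball_le x r : 0 <= r -> (diam (ball x r) <= (d%:R * (2 * r))%:E)%E.
Proof.
move=> r0; apply: ge_ereal_sup => _ [[y z] /= [/rV_ballP[_ xy] /rV_ballP[_ xz]] <-].
rewrite lee_fin; apply: edist_le => [|j]; first by rewrite mulr_ge0.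
have := xy j; have := xz j; rewrite !ltr_norml ler_norml => /andP[? ?] /andP[? ?].
by lra.
Qed.

Lemma hausdorff_premeasure_ge0 s delta A : (0 <= hausdorff_premeasure s delta A)%E.
Proof.
apply: le_ereal_inf_tmp => _ [U _ <-]; apply: nneseries_ge0 => n _ _.
exact: diam_pow_ge0.
Qed.

Lemma hausdorff_measure_ge0 s A : (0 <= hausdorff_measure s A)%E.
Proof.
apply: (@le_trans _ _ (hausdorff_premeasure s 1 A)).
  exact: hausdorff_premeasure_ge0.
by apply: ereal_sup_ubound; exists 1 => //=.
Qed.

(** Enlarging the [i]-th radius so that its power grows by [eps / 2 ^+ i.+1]
    makes it exceed the diameter, hence turns arbitrary covering sets into open
    balls; this also takes care of singletons, whose diameter is 0. *)
Lemma small_cover_of_cover s eps A (U : nat -> set 'rV[R]_d) : 0 < s -> 0 < eps ->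
  A `<=` \bigcup_i U i -> (\sum_(0 <= i <oo) diam_pow s (U i) < eps%:E)%E ->
  small_cover s (eps + eps) A.
Proof.
move=> s0 eps0 AU sU.
have dpi n : (\sum_(0 <= i < n) diam_pow s (U i) < eps%:E)%E.
  apply: le_lt_trans sU; apply: nneseries_lim_ge => *; exact: diam_pow_ge0.
have dpfin i : diam_pow s (U i) \is a fin_num.
  rewrite ge0_fin_numE ?diam_pow_ge0//.
  apply: (@lt_trans _ _ eps%:E); last exact: ltry.
  apply: le_lt_trans (dpi i.+1); rewrite big_nat_recr//= leeDr//.
  by apply: sume_ge0 => *; exact: diam_pow_ge0.
pose D i := fine (diam_pow s (U i)).
have D0 i : 0 <= D i by exact/fine_ge0/diam_pow_ge0.
have e0 i : 0 < eps / 2 ^+ i.+1 by rewrite divr_gt0// exprn_gt0.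
exists (fun i => xget 0 (U i)), (fun i => (D i + eps / 2 ^+ i.+1) `^ s^-1); split.
- by move=> i; exact: powR_ge0.
- move=> y /AU[i _ Uiy]; exists i => //; set x := xget _ _.
  have Uix : U i x by apply: xgetPex; exists y.
  apply/rV_ballP; split=> [|j].
    by rewrite powR_gt0// ltr_wpDl.
  apply: le_lt_trans (coord_le_edist _ _ _) _.
  have := edist_le_diam Uix Uiy; have := diam_ge0 Uix.
  have : (diam (U i) `^ s)%E = (D i)%:E.
    rewrite /D fineK// /diam_pow ifF//; apply/eqP => U0.
    by move: Uix; rewrite U0.
  case: (diam (U i)) => [r|/=|//]; last by rewrite gt_eqF.
  rewrite poweR_EFin => -[rD]; rewrite !lee_fin => r0 xyr.
  apply: (le_lt_trans xyr).
  have -> : r = D i `^ s^-1 by rewrite -rD -powRrM divff ?gt_eqF// powRr1.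
  by apply: gt0_ltr_powR; rewrite ?invr_gt0 ?nnegrE ?addr_ge0 ?ltrDl// ltW.
- move=> n; under eq_bigr do rewrite powR_root ?addr_ge0 ?(ltW (e0 _))//.
  rewrite big_split/= lerD ?half_sum//.
  rewrite -lee_fin -sumEFin; under eq_bigr do rewrite fineK//.
  exact/ltW.
Qed.

Lemma hausdorff_measure_hnull s A : 0 < s ->
  hausdorff_measure s A = 0%E -> hnull s A.
Proof.
move=> s0 A0 eps eps0; rewrite (splitr eps).
have eps2 : 0 < eps / 2 by rewrite divr_gt0.
have : (hausdorff_premeasure s 1 A < (eps / 2)%:E)%E.
  apply: (@le_lt_trans _ _ (hausdorff_measure s A)); last by rewrite A0 lte_fin.
  by apply: ereal_sup_ubound; exists 1 => /=.
by move=> /ereal_inf_lt[_ [U [AU _] <-]]; exact: small_cover_of_cover.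
Qed.

(** A bound on the sum bounds each radius, so a cover with small sum is
    automatically a cover by sets of diameter at most [delta]. *)
Lemma hnull_hausdorff_measure s A : 0 < s ->
  hnull s A -> hausdorff_measure s A = 0%E.
Proof.
move=> s0 nA; apply/eqP; rewrite eq_le hausdorff_measure_ge0 andbT.
apply: ge_ereal_sup => _ [delta delta0 <-].
apply/lee_addgt0Pr => e e0; rewrite add0e.
(* A sup-norm ball of radius [r] has Euclidean diameter at most [C * r]; the
   successor keeps [C] positive when [d = 0]. *)
pose C : R := d.+1%:R * 2.
have C0 : 0 < C by rewrite mulr_gt0.
have Cs0 : 0 < C `^ s by exact: powR_gt0.
have m0 : 0 < Num.min (e / C `^ s) ((delta / C) `^ s).
  by rewrite lt_min divr_gt0//= powR_gt0// divr_gt0.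
have [x [r [r0 Ax sr]]] := nA _ m0.
have diamr i : (diam (ball (x i) (r i)) <= (C * r i)%:E)%E.
  apply: le_trans (diam_ball_le _ (r0 i)) _.
  by rewrite lee_fin /C mulrA ler_wpM2r// ler_pM2r// ler_nat.
apply: (@le_trans _ _ (\sum_(0 <= i <oo) diam_pow s (ball (x i) (r i)))%E).
  apply: ereal_inf_lbound; exists (fun i => ball (x i) (r i)) => //; split => //.
  move=> i; apply: le_trans (diamr i) _; rewrite lee_fin mulrC -ler_pdivlMr//.
  rewrite leNgt; apply/negP => dr.
  have := gt0_ltr_powR s0 _ _ dr; rewrite !nnegrE r0 divr_ge0 ?(ltW C0) ?(ltW delta0)//.
  move=> /(_ isT isT); apply/negP; rewrite -leNgt.
  apply: (@le_trans _ _ (\sum_(0 <= j < i.+1) r j `^ s)).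
    by rewrite big_nat_recr//= lerDr; apply: sumr_ge0 => *; exact: powR_ge0.
  by apply: le_trans (sr _) _; rewrite ge_min lexx orbT.
apply: lime_le.
  by apply: is_cvg_nneseries => *; exact: diam_pow_ge0.
apply: nearW => n.
apply: (@le_trans _ _ (\sum_(0 <= i < n) (C `^ s * r i `^ s)%:E)%E).
  apply: lee_sum => i _; rewrite -powRM ?(ltW C0)// /diam_pow; case: ifPn => [_|].
    by rewrite lee_fin powR_ge0.
  move=> /set0P[z xz]; rewrite -poweR_EFin; apply: gt0_ler_poweR => //.
  - exact: ltW.
  - by rewrite in_itv/= (diam_ge0 xz) leey.
  - by rewrite in_itv/= lee_fin mulr_ge0// ?(ltW C0)// leey.
rewrite sumEFin -mulr_sumr lee_fin mulrC -ler_pdivlMr//.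
by apply: le_trans (sr _) _; rewrite ge_min lexx.
Qed.

Lemma hausdorff_dim_gtP A (p : R) : 0 <= p ->
  (p%:E < hausdorff_dim A)%E <-> exists2 s, p < s & ~ hnull s A.
Proof.
move=> p0; rewrite /hausdorff_dim lt_max [X in X || _](_ : _ = false)/=; last first.
  by apply/negbTE; rewrite -leNgt lee_fin.
split.
  move=> /ereal_sup_gt[_ [s [s0 sA] <-]]; rewrite lte_fin => ps; exists s => //.
  move=> /(hnull_hausdorff_measure (le_lt_trans p0 ps)) sA0.
  by rewrite sA0 ltxx in sA.
move=> [s ps snA]; apply: (@lt_le_trans _ _ s%:E); first by rewrite lte_fin.
have s0 := le_lt_trans p0 ps.
apply: ereal_sup_ubound; exists s => //=; split; first exact: ltW.
rewrite lt_neqAle hausdorff_measure_ge0 andbT; apply/negP => /eqP/esym.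
by move=> /(hausdorff_measure_hnull s0).
Qed.

End hausdorff.

(** * Borel complexity in the upper Fell topology *)

Section borel_levels.

Lemma Sigma0_1_open (T : topologicalType) (S : set T) : Sigma0 1 S -> open S.
Proof.
move E : 1%N => n H; case: n S / H E => // n S F m n1 _ _ _ n_eq.
by rewrite -n_eq in n1.
Qed.

Lemma Sigma0_2P (T : topologicalType) (S : set T) :
  Sigma0 2 S <-> exists2 F : nat -> set T, (forall i, closed (F i)) & S = \bigcup_i F i.
Proof.
split=> [|[F Fc ->]]; last first.
  apply: (@Sigma0_bigcup _ _ _ F (fun=> 1%N)) => // i.
  by apply: Sigma0_open; rewrite openC.
move E : 2%N => k H; case: k S / H E => // n S F m n1 mn HF -> n2.
exists F => // i; rewrite -openC.
have : m i = 1%N by have := mn i; rewrite -n2; case: (m i) => [|[|]].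
by move: (HF i) => /[swap] ->; exact: Sigma0_1_open.
Qed.

Lemma Sigma0_preimage (T U : topologicalType) (f : T -> U) n (S : set U) :
  continuous f -> Sigma0 n S -> Sigma0 n (f @^-1` S).
Proof.
move=> fc; elim=> {n S} [S oS|n S F m n1 mn _ ih ->].
  by apply: Sigma0_open; move/continuousP: fc; exact.
by apply: (@Sigma0_bigcup _ _ _ (fun i => f @^-1` F i) m) => //; rewrite preimage_bigcup.
Qed.

(** Indices that encode no element of [I] contribute the empty set, whose
    complement is open. *)
Lemma Sigma0_bigcup_countType (I : countType) (T : topologicalType) n (F : I -> set T) :
  (0 < n)%N -> (forall i, Sigma0 n (~` F i)) -> Sigma0 n.+1 (\bigcup_i F i).
Proof.
move=> n0 HF; have sT : Sigma0 1 (~` (set0 : set T)).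
  by rewrite setC0; apply: Sigma0_open; exact: openT.
pose G (k : nat) : set T := if @unpickle I k is Some i then F i else set0.
pose m (k : nat) := if @unpickle I k is Some _ then n else 1%N.
apply: (@Sigma0_bigcup _ _ _ G m); rewrite /G /m => //.
- by move=> k; case: unpickle => [i|]; rewrite ?n0 ?ltnSn.
- by move=> k; case: unpickle.
- apply/seteqP; split=> x [].
    by move=> i _ Fix; exists (pickle i) => //; rewrite pickleK.
  by move=> k _; case: unpickle => // i Fix; exists i.
Qed.

Lemma Sigma0_2_closed (T : topologicalType) (S : set T) : closed S -> Sigma0 2 S.
Proof.
by move=> Sc; apply/Sigma0_2P; exists (fun=> S) => //; rewrite bigcup_const.
Qed.

Lemma Sigma0_2_bigcup (I : countType) (T : topologicalType) (S : I -> set T) :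
  (forall i, Sigma0 2 (S i)) -> Sigma0 2 (\bigcup_i S i).
Proof.
move=> HS; have /choice[F FS] : forall i, exists F : nat -> set T,
    (forall i, closed (F i)) /\ S i = \bigcup_i F i.
  by move=> i; have /Sigma0_2P[F] := HS i; exists F.
have -> : \bigcup_i S i = \bigcup_(p : I * nat) F p.1 p.2.
  apply/seteqP; split=> x [].
    by move=> i _; have [_ ->] := FS i => -[k _ xF]; exists (i, k).
  by move=> [i k] _ /= xF; exists i => //; have [_ ->] := FS i; exists k.
apply: Sigma0_bigcup_countType => // -[i k]; apply: Sigma0_open; rewrite openC.
by have [+ _] := FS i; exact.
Qed.

Lemma Sigma0_2_setI (T : topologicalType) (S C : set T) :
  Sigma0 2 S -> closed C -> Sigma0 2 (S `&` C).
Proof.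
move=> /Sigma0_2P[F Fc ->] Cc; rewrite setIC setI_bigcupr.
by apply/Sigma0_2P; exists (fun i => C `&` F i) => // i; exact: closedI.
Qed.

Lemma Sigma0_2_setU (T : topologicalType) (S1 S2 : set T) :
  Sigma0 2 S1 -> Sigma0 2 S2 -> Sigma0 2 (S1 `|` S2).
Proof.
move=> H1 H2; have -> : S1 `|` S2 = \bigcup_(b : bool) if b then S1 else S2.
  apply/seteqP; split=> x; first by case=> Sx; [exists true|exists false].
  by move=> [[] _ Sx]; [left|right].
by apply: Sigma0_2_bigcup => -[].
Qed.

End borel_levels.

Lemma open_bigcap_finite (X : topologicalType) (I : choiceType) (D : set I)
    (f : I -> set X) :
  finite_set D -> (forall i, D i -> open (f i)) -> open (\bigcap_(i in D) f i).
Proof.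
move=> Dfin fo; rewrite -closedC setC_bigcap; apply: closed_bigcup => // i Di.
by rewrite closedC; exact: fo.
Qed.

Section fell_basics.
Variable T : topologicalType.

Lemma open_upper_miss (K : set T) : compact K -> open (miss K : set (upper_fell T)).
Proof.
move=> cK; exists [set (miss K : set (upper_fell T))]; last by rewrite bigcup_set1.
by move=> _ ->; apply: finI_from1; exists K.
Qed.

Lemma continuous_fell (X : topologicalType) (f : X -> fell T) :
  (forall K, compact K -> open (f @^-1` miss K)) ->
  (forall U, open U -> open (f @^-1` hit U)) -> continuous f.
Proof.
move=> fK fU; apply/continuousP => _ [D' D'D <-].
rewrite preimage_bigcup; apply: bigcup_open => B /D'D [E ED <-].
rewrite preimage_bigcap; apply: open_bigcap_finite => [|C /= EC].
  exact: finite_fset.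
by have := ED _ EC; rewrite inE => -[[K cK <-]|[U oU <-]]; [exact: fK|exact: fU].
Qed.

Lemma continuous_fell_upper : continuous (id : fell T -> upper_fell T).
Proof.
apply/continuousP => _ [D' D'D <-].
rewrite preimage_bigcup; apply: bigcup_open => B /D'D [E ED <-].
rewrite preimage_bigcap; apply: open_bigcap_finite => [|C /= EC].
  exact: finite_fset.
have := ED _ EC; rewrite inE => -[K cK <-].
exists [set (miss K : set (fell T))]; last by rewrite bigcup_set1.
by move=> _ ->; apply: finI_from1; left; exists K.
Qed.

End fell_basics.

Section upper_bounds.
Variables (R : realType) (d : nat).
Implicit Types (A : closedSet 'rV[R]_d) (s a : R).

(** Written as a product of segments, so that compactness is Tychonoff's
    theorem. *)
Definition cube (n : nat) : set 'rV[R]_d := [set v | forall i, `[- n%:R, n%:R]%classic (v ord0 i)].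

Lemma compact_cube n : compact (cube n).
Proof.
apply: (@rV_compact R d (fun=> `[- n%:R, n%:R]%classic)) => i.
exact: segment_compact.
Qed.

Lemma bigcup_cube : \bigcup_n cube n = setT.
Proof.
apply/seteqP; split=> // v _; exists (Num.truncn (mx_norm v)).+1 => // i /=.
rewrite in_itv/= -ler_norml; apply: (@le_trans _ _ (mx_norm v)).
  by rewrite mx_normrE; exact: (le_bigmax _ (fun ij => `|v ij.1 ij.2|) (ord0, i)).
exact/ltW/truncnS_gt.
Qed.

(** Only covers of the part of [A] inside a fixed compact cube can be tested
    by the upper Fell topology. *)
Definition cover_near s (n m : nat) : set (upper_fell 'rV[R]_d) :=
  [set A | small_cover s m.+1%:R^-1 (carrier A `&` cube n)].

(** A fixed family of balls covers [A] inside the cube iff [A] misses the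
    compact set that remains of the cube once the balls are removed. *)
Lemma open_cover_near s n m : open (cover_near s n m).
Proof.
have -> : cover_near s n m = \bigcup_(xr in [set xr : (nat -> 'rV[R]_d) * (nat -> R) |
    (forall i, 0 <= xr.2 i) /\ forall k, \sum_(0 <= i < k) xr.2 i `^ s <= m.+1%:R^-1])
    (miss (cube n `\` \bigcup_i ball (xr.1 i) (xr.2 i)) : set (upper_fell _)).
  apply/seteqP; split=> A.
    move=> [x [r [r0 Ax sr]]]; exists (x, r) => //.
    apply/seteqP; split=> // y [/= Ay [Ky]]; apply; exact: Ax.
  move=> [[x r] /= [r0 sr] Axr]; exists x, r; split => // y [Ay Ky].
  by apply: contrapT => ny; rewrite -[False]/(set0 y) -Axr.
apply: bigcup_open => -[x r] _ /=; apply: open_upper_miss.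
apply: (@subclosed_compact _ _ (cube n)); [|exact: compact_cube|by move=> ? []].
rewrite setDE; apply: closedI; last first.
  by apply: open_closedC; apply: bigcup_open => i _; exact: ball_open.
apply: compact_closed; [exact: norm_hausdorff|exact: compact_cube].
Qed.

Lemma hnull_cover_near s A : hnull s (carrier A) <-> forall n m, cover_near s n m A.
Proof.
split=> [nA n m|cA].
  apply: (hnullS _ nA); last by rewrite invr_gt0.
  exact: subIsetl.
rewrite -[carrier A]setIT -bigcup_cube setI_bigcupr; apply: hnull_bigcup => n eps eps0.
have [m me] : exists m, m.+1%:R^-1 < eps.
  exists (Num.truncn eps^-1); rewrite invf_plt ?posrE//; exact: truncnS_gt.
have [x [r [r0 Ax sr]]] := cA n m; exists x, r; split => // k.
exact: (le_trans (sr k) (ltW me)).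
Qed.

(** For negative [a] all closed sets qualify, as dimensions are nonnegative;
    having all real [a] avoids side conditions on rational thresholds later. *)
Lemma Sigma0_2_dim_gt a :
  Sigma0 2 [set A : upper_fell 'rV[R]_d | (a%:E < hausdorff_dim (carrier A))%E].
Proof.
have [a0|a0] := ltP a 0.
  rewrite (_ : mkset _ = setT); first by apply: Sigma0_2_closed; exact: closedT.
  apply/seteqP; split=> // A _ /=.
  by apply: (@lt_le_trans _ _ 0%E); rewrite ?lte_fin// le_max lexx.
rewrite (_ : mkset _ = \bigcup_(p : rat * nat * nat)
   (if a < ratr p.1.1 then ~` cover_near (ratr p.1.1) p.1.2 p.2 else set0)).
  apply: Sigma0_2_bigcup => p; apply: Sigma0_2_closed; case: ifP => _; last exact: closed0.
  by apply: open_closedC; exact: open_cover_near.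
apply/seteqP; split=> A /=.
  move=> /(hausdorff_dim_gtP _ a0)[s ps nA].
  have [b /andP[ab bs]] : exists q : rat, a < ratr q < s.
    by have [q] := rat_in_itvoo ps; rewrite in_itv/= => qs; exists q.
  have : ~ hnull (ratr b) (carrier A).
    by apply: contra_not nA; apply: hnull_le; [exact: le_lt_trans ab|exact: ltW].
  move=> /hnull_cover_near/existsNP[n /existsNP[m nm]]; exists (b, n, m) => //=.
  by rewrite ab.
move=> [[[b n] m] _] /=; case: ifP => // ab nA.
apply/(hausdorff_dim_gtP _ a0); exists (ratr b) => //.
by move=> /hnull_cover_near/(_ n m).
Qed.

End upper_bounds.

Section dimension_levels.
Variables (R : realType) (d : nat).
Let Y : topologicalType := (upper_fell 'rV[R]_d * `[0, d%:R : R]%classic)%type.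

Lemma param_continuous : continuous (fun Ap : Y => set_val Ap.2 : R).
Proof.
move=> x; apply: (@continuous_comp _ _ _ snd (set_val : `[0, d%:R : R]%classic -> R)).
  exact: cvg_snd.
exact: initial_continuous.
Qed.

Lemma Sigma0_2_dim_gt_param : Sigma0 2
  [set Ap : Y | ((set_val Ap.2)%:E < hausdorff_dim (carrier Ap.1))%E].
Proof.
rewrite (_ : mkset _ = \bigcup_(a : rat)
  ((fst @^-1` [set A : upper_fell 'rV[R]_d | ((ratr a)%:E < hausdorff_dim (carrier A))%E]) `&`
   [set Ap : Y | set_val Ap.2 <= ratr a :> R])).
  apply: Sigma0_2_bigcup => a; apply: Sigma0_2_setI.
    by apply: Sigma0_preimage; [move=> x; exact: cvg_fst|exact: Sigma0_2_dim_gt].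
  apply: (@preimage_closed _ _ (fun Ap : Y => set_val Ap.2 : R) [set x | x <= ratr a]).
    by move=> x _; exact: param_continuous.
  exact: closed_le.
apply/seteqP; split=> -[A p] /=.
  have p0 : 0 <= set_val p :> R by have := set_valP p; rewrite /= in_itv/= => /andP[].
  move=> /(hausdorff_dim_gtP _ p0)[s ps nA].
  have [b] := rat_in_itvoo ps; rewrite in_itv/= => /andP[pb bs]; exists b => //=.
  split; last exact: ltW.
  by apply/hausdorff_dim_gtP; [apply: ltW; exact: le_lt_trans pb|exists s].
by move=> [a _ [/= aA pa]]; apply: le_lt_trans aA; rewrite lee_fin.
Qed.

Lemma Pi0_3_dim_ge_param : Pi0 3
  [set Ap : Y | ((set_val Ap.2)%:E <= hausdorff_dim (carrier Ap.1))%E].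
Proof.
rewrite /Pi0 (_ : ~` _ = \bigcup_(a : rat)
  ~` ((fst @^-1` [set A : upper_fell 'rV[R]_d | ((ratr a)%:E < hausdorff_dim (carrier A))%E]) `|`
   [set Ap : Y | set_val Ap.2 <= ratr a :> R])).
  apply: Sigma0_bigcup_countType => // a; rewrite setCK; apply: Sigma0_2_setU.
    by apply: Sigma0_preimage; [move=> x; exact: cvg_fst|exact: Sigma0_2_dim_gt].
  apply: Sigma0_2_closed.
  apply: (@preimage_closed _ _ (fun Ap : Y => set_val Ap.2 : R) [set x | x <= ratr a]).
    by move=> x _; exact: param_continuous.
  exact: closed_le.
apply/seteqP; split=> -[A p] /=.
  move=> /negP; rewrite -ltNge.
  have : (0 <= hausdorff_dim (carrier A))%E by rewrite le_max lexx.
  case DE : (hausdorff_dim (carrier A)) => [D| |]// D0; rewrite lte_fin => Dp.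
  have [b] := rat_in_itvoo Dp; rewrite in_itv/= => /andP[Db bp]; exists b => //=.
  by move=> [|]; apply/negP; [rewrite -leNgt DE lee_fin ltW|rewrite -ltNge].
move=> [a _] /not_orP[/negP + /negP]; rewrite -leNgt -ltNge => Aa ap pA.
have := le_trans pA Aa; rewrite lee_fin => pa.
by have := lt_le_trans ap pa; rewrite ltxx.
Qed.

Lemma fell_slice_continuous (p : `[0, d%:R : R]%classic) :
  continuous (fun A : fell 'rV[R]_d => (A : upper_fell 'rV[R]_d, p) : Y).
Proof.
by move=> A; exact: (cvg_pair (@continuous_fell_upper _ A) (cvg_cst p)).
Qed.

End dimension_levels.

(** * Cantor dusts of prescribed dimension *)

Section binary_digits.
Variable R : realType.
Implicit Types t : R.

(** The number of the dyadic interval of length [2 ^- m] that contains [t]. *)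
Definition dyadic m t : nat := Num.truncn (2 ^+ m * t).

(** The binary digits of [t] in [0, 1[, from the digit of weight 1/2 on; they
    determine [dyadic m t] ([dyadic_bits]) and conversely ([bits_dyadic]). *)
Definition bit m t : bool := odd (dyadic m.+1 t).

Lemma dyadic_itv m t : 0 <= t ->
  (dyadic m t)%:R <= 2 ^+ m * t < (dyadic m t).+1%:R.
Proof. by move=> t0; apply: truncn_itv; rewrite mulr_ge0// exprn_ge0. Qed.

Lemma dyadic_half m t : 0 <= t -> dyadic m t = (dyadic m.+1 t)./2.
Proof.
move=> t0; apply/eqP; rewrite truncn_eq; last by rewrite mulr_ge0// exprn_ge0.
have /andP[] := dyadic_itv m.+1 t0; set N := dyadic m.+1 t.
have : N%:R = (odd N)%:R + 2 * (N./2)%:R :> R.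
  by rewrite -[in LHS](odd_double_half N) natrD -muln2 natrM mulrC.
rewrite exprS -[N.+1]addn1 -[N./2.+1]addn1 !natrD -mulrA => -> ? ?.
have : (odd N)%:R <= 1 :> R by case: odd.
have : 0 <= (odd N)%:R :> R by [].
by move=> ? ?; apply/andP; split; lra.
Qed.

Lemma dyadic0 t : 0 <= t < 1 -> dyadic 0 t = 0%N.
Proof.
move=> /andP[t0 t1]; apply/eqP; rewrite /dyadic expr0 mul1r.
by rewrite truncn_eq// t0 t1.
Qed.

Lemma dyadic_bits m t u : 0 <= t < 1 -> 0 <= u < 1 ->
  (forall k, (k < m)%N -> bit k t = bit k u) -> dyadic m t = dyadic m u.
Proof.
move=> t01 u01; have [t0 u0] : 0 <= t /\ 0 <= u.
  by case/andP: t01 => -> _; case/andP: u01 => -> _.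
elim: m => [|m ih] tu; first by rewrite !dyadic0.
rewrite -(odd_double_half (dyadic m.+1 t)) -(odd_double_half (dyadic m.+1 u)).
rewrite -!dyadic_half// ih => [|k km]; last by apply: tu; rewrite ltnW.
by congr (_ + _)%N; rewrite -/(bit m t) tu.
Qed.

Lemma bits_dyadic m t u : 0 <= t -> 0 <= u -> dyadic m t = dyadic m u ->
  forall k, (k < m)%N -> bit k t = bit k u.
Proof.
move=> t0 u0; elim: m => // m ih tu k; rewrite ltnS leq_eqVlt => /orP[/eqP ->|km].
  by rewrite /bit tu.
by apply: ih => //; rewrite (dyadic_half m t0) (dyadic_half m u0) tu.
Qed.

Lemma dyadic_dist m t u : 0 <= t -> 0 <= u -> dyadic m t = dyadic m u ->
  `|t - u| <= (2 ^+ m)^-1.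
Proof.
move=> t0 u0 tu; have /andP[] := dyadic_itv m t0; have /andP[] := dyadic_itv m u0.
rewrite tu -[_.+1]addn1 natrD => ? ? ? ?.
have m0 : 0 < 2 ^+ m :> R by rewrite exprn_gt0.
rewrite -[leRHS]mul1r ler_pdivlMr// -[X in _ * X](ger0_norm (ltW m0)) -normrM.
by rewrite ler_norml; apply/andP; split; lra.
Qed.

Lemma dyadic_lt m t : 0 <= t < 1 -> (dyadic m t < 2 ^ m)%N.
Proof.
move=> /andP[t0 t1]; have /andP[+ _] := dyadic_itv m t0.
rewrite -(ltr_nat R) natrX => /le_lt_trans; apply.
by rewrite gtr_pMr// exprn_gt0.
Qed.

Lemma dyadic_frac a m : dyadic m (a%:R / 2 ^+ m) = a.
Proof. by rewrite /dyadic mulrC divfK ?natrK// expf_neq0. Qed.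

Lemma dyadic_frac_itv a m : (a < 2 ^ m)%N -> 0 <= (a%:R / 2 ^+ m : R) < 1.
Proof.
move=> am; rewrite divr_ge0//= ltr_pdivrMr ?exprn_gt0// mul1r.
by rewrite -natrX ltr_nat.
Qed.

End binary_digits.

Section cantor_series.
Variables (R : realType) (b : R).
Hypothesis b01 : 0 < b < 1.
Implicit Types e f : nat -> bool.

Let b0 : 0 < b. Proof. by case/andP: b01. Qed.
Let b1 : b < 1. Proof. by case/andP: b01. Qed.
Let bn0 n : 0 < b ^+ n. Proof. exact: exprn_gt0. Qed.
Let B0 : 0 < 1 - b. Proof. by rewrite subr_gt0. Qed.

Definition digsum e n : R := \sum_(0 <= j < n) (e j)%:R * b ^+ j.

(** The sum of the series [\sum_j e_j b ^+ j], as the supremum of its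
    nondecreasing partial sums. *)
Definition cantor_point e : R := sup (range (digsum e)).

Lemma digsumS e n : digsum e n.+1 = digsum e n + (e n)%:R * b ^+ n.
Proof. by rewrite /digsum big_nat_recr. Qed.

Lemma digsum_le e n m : (n <= m)%N -> digsum e n <= digsum e m.
Proof.
move=> /subnKC <-; elim: (m - n)%N => [|k ih]; first by rewrite addn0.
by rewrite addnS digsumS (le_trans ih)// lerDl mulr_ge0// ltW.
Qed.

Lemma digsum_tail e n m : digsum e m <= digsum e n + b ^+ n / (1 - b).
Proof.
have [mn|nm] := leqP m n.
  by rewrite (le_trans (digsum_le e mn))// lerDl divr_ge0// ltW.
suff : digsum e m <= digsum e n + (b ^+ n - b ^+ m) / (1 - b).
  by move/le_trans; apply; rewrite lerD2l ler_pM2r ?invr_gt0// gerBl ltW.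
rewrite -(subnKC (ltnW nm)); elim: (m - n)%N => [|k ih].
  by rewrite addn0 subrr mul0r addr0.
rewrite addnS digsumS.
have -> : (b ^+ n - b ^+ (n + k).+1) / (1 - b) =
    (b ^+ n - b ^+ (n + k)) / (1 - b) + b ^+ (n + k).
  by rewrite exprS; field; rewrite gt_eqF.
by rewrite addrA lerD// -[leRHS]mul1r ler_pM2r//; case: (e _).
Qed.

Lemma cantor_point_ge e n : digsum e n <= cantor_point e.
Proof.
apply: ub_le_sup; last by exists n.
by exists (digsum e 0 + b ^+ 0 / (1 - b)) => _ [m _ <-]; exact: digsum_tail.
Qed.

Lemma cantor_point_le e n : cantor_point e <= digsum e n + b ^+ n / (1 - b).
Proof.
apply: ge_sup; first by exists (digsum e 0); exists 0%N.
by move=> _ [m _ <-]; exact: digsum_tail.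
Qed.

Lemma eq_digsum e f n : (forall j, (j < n)%N -> e j = f j) -> digsum e n = digsum f n.
Proof. by move=> ef; apply: eq_big_nat => j /andP[_ jn]; rewrite ef. Qed.

Lemma cantor_point_close e f n : (forall j, (j < n)%N -> e j = f j) ->
  `|cantor_point e - cantor_point f| <= b ^+ n / (1 - b).
Proof.
move=> /eq_digsum ef; have := cantor_point_ge e n; have := cantor_point_le e n.
have := cantor_point_ge f n; have := cantor_point_le f n; rewrite ef => *.
by rewrite ler_norml; apply/andP; split; lra.
Qed.

(** The digit at [n] contributes [b ^+ n], while all later digits together
    contribute at most [b ^+ n.+1 / (1 - b)]. *)
Lemma cantor_point_first e f n : (forall j, (j < n)%N -> e j = f j) ->
  e n -> ~~ f n ->
  b ^+ n * ((1 - 2 * b) / (1 - b)) <= cantor_point e - cantor_point f.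
Proof.
move=> ef en fn; have := cantor_point_ge e n.+1; have := cantor_point_le f n.+1.
rewrite !digsumS (eq_digsum ef) en (negbTE fn) mul1r mul0r addr0 => h1 h2.
have -> : b ^+ n * ((1 - 2 * b) / (1 - b)) = b ^+ n - b ^+ n.+1 / (1 - b).
  by rewrite exprS; field; rewrite gt_eqF.
by lra.
Qed.

Lemma cantor_point_separated e f n : 2 * b < 1 ->
  (exists2 j, (j < n)%N & e j != f j) ->
  b ^+ n * ((1 - 2 * b) / (1 - b)) <= `|cantor_point e - cantor_point f|.
Proof.
move=> b2 [j0 j0n ej0].
have ex : exists j, e j != f j by exists j0.
have [j efj jmin] := ex_minnP ex.
have agree k : (k < j)%N -> e k = f k.
  by move=> kj; apply/eqP; apply: contraTT kj => /jmin; rewrite -leqNgt.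
have jn : (j <= n)%N by rewrite (leq_trans (jmin _ ej0))// ltnW.
have c0 : 0 < (1 - 2 * b) / (1 - b) by rewrite divr_gt0// subr_gt0.
apply: (@le_trans _ _ (b ^+ j * ((1 - 2 * b) / (1 - b)))).
  by rewrite ler_pM2r// ler_wiXn2l// ltW.
case ej : (e j) efj; case fj : (f j) => // _.
  apply: le_trans (ler_norm _); apply: cantor_point_first => //.
  by rewrite fj.
rewrite distrC; apply: le_trans (ler_norm _); apply: cantor_point_first => //.
  by move=> k /agree.
by rewrite ej.
Qed.

End cantor_series.

Lemma expr_small (R : realType) (z e : R) : 0 <= z < 1 -> 0 < e -> exists n, z ^+ n < e.
Proof.
move=> /andP[z0 z1] e0.
have : z ^+ n @[n --> \oo] --> 0 by apply: cvg_expr; rewrite ger0_norm.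
move=> /cvgrPdist_lt/(_ _ e0)[n _ /(_ n (leqnn n))] /=.
by rewrite sub0r normrN ger0_norm ?exprn_ge0// => zn; exists n.
Qed.

Section cantor_dust.
Variables (R : realType) (d : nat) (s : R) (v : 'rV[R]_d).
Hypothesis d0 : (0 < d)%N.
Hypothesis s0d : 0 < s < d%:R.

Let s0 : 0 < s. Proof. by case/andP: s0d. Qed.

(* The ratio is chosen so that [b `^ s = 2 ^- d]; [s < d] makes it smaller than
   1/2, so that digits can be recovered from the sum. *)
Let b : R := 2 `^ (- (d%:R / s)).

Let b0 : 0 < b. Proof. by rewrite powR_gt0. Qed.

Let b_half : 2 * b < 1.
Proof.
have sd : 1 < d%:R / s by rewrite ltr_pdivlMr// mul1r; case/andP: s0d.
rewrite -[X in X * _](@powRr1 R)// /b -powRD ?pnatr_eq0 ?implybT//.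
rewrite /powR pnatr_eq0/= expR_lt1 nmulr_rlt0 ?subr_lt0//.
by rewrite ln_gt0// ltr1n.
Qed.

Let b01 : 0 < b < 1. Proof. by rewrite b0/=; have := b_half; have := b0; lra. Qed.

Let powb : b `^ s = (2 ^+ d)^-1.
Proof. by rewrite -powRrM mulNr divfK ?gt_eqF// powRN powR_mulrn. Qed.

Let powbn n : (b ^+ n) `^ s = (2 ^+ (d * n))^-1.
Proof.
rewrite -powR_mulrn ?(ltW b0)// -powRrM mulrC powRrM powb powR_mulrn.
  by rewrite exprVn exprM.
by rewrite invr_ge0 exprn_ge0.
Qed.

(** Coordinate [i] reads the binary digits of [t] at the positions congruent
    to [i] modulo [d]; so the first [n] digits of all coordinates are the first
    [d * n] digits of [t]. *)
Definition dust (t : R) : 'rV[R]_d :=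
  \row_i (v 0 i + cantor_point b (fun j => bit (d * j + i) t)).

Let D : R := (1 - b)^-1.
Let D0 : 0 < D. Proof. by rewrite invr_gt0 subr_gt0; case/andP: b01. Qed.

Lemma dust_ge t i : v 0 i <= dust t 0 i.
Proof.
rewrite mxE lerDl; apply: le_trans (cantor_point_ge b01 _ 0).
by rewrite /digsum big_geq.
Qed.

Lemma dust_close n t u i : 0 <= t -> 0 <= u ->
  dyadic (d * n) t = dyadic (d * n) u -> `|dust t 0 i - dust u 0 i| <= b ^+ n * D.
Proof.
move=> t0 u0 tu; rewrite !mxE opprD addrACA subrr add0r.
apply: (cantor_point_close b01) => j jn; apply: (bits_dyadic t0 u0 tu).
by rewrite (@leq_trans (d * j.+1))// ?leq_mul2l ?jn ?orbT// mulnS addnC ltn_add2r.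
Qed.

Lemma dust_separated n t u : 0 <= t < 1 -> 0 <= u < 1 ->
  dyadic (d * n) t <> dyadic (d * n) u ->
  exists i, b ^+ n * ((1 - 2 * b) * D) <= `|dust t 0 i - dust u 0 i|.
Proof.
move=> t01 u01 tu.
have [k kdn bk] : exists2 k, (k < d * n)%N & bit k t != bit k u.
  apply: contrapT => nk; apply: tu; apply: dyadic_bits => // k kdn.
  by apply/eqP; apply: contraT => bk; case: nk; exists k.
exists (Ordinal (ltn_pmod k d0)); rewrite !mxE opprD addrACA subrr add0r.
apply: (cantor_point_separated b01 b_half); exists (k %/ d)%N.
  by rewrite ltn_divLR// mulnC.
by rewrite /= mulnC -divn_eq.
Qed.

Let K : R := (2 / (b * ((1 - 2 * b) * D))) `^ s.

Let K0 : 0 < K.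
Proof.
rewrite powR_gt0// divr_gt0// !mulr_gt0// subr_gt0//.
Qed.

(** Let [n] be the first level whose gaps are not larger than the ball. Points
    in the ball agree up to level [n.-1], so [t] and [u] lie in one dyadic
    interval of length [2 ^- (d * n.-1)], which is [(b ^+ n.-1) `^ s] and so
    comparable to [r `^ s]. *)
Lemma dust_holder t u x r : 0 <= t < 1 -> 0 <= u < 1 ->
  ball x r (dust t) -> ball x r (dust u) -> `|t - u| <= K * r `^ s.
Proof.
move=> t01 u01 /rV_ballP[r0 xt] /rV_ballP[_ xu].
have [t0 u0] : 0 <= t /\ 0 <= u.
  by case/andP: t01 => -> _; case/andP: u01 => -> _.
set c := (1 - 2 * b) * D.
have c0 : 0 < c by rewrite mulr_gt0// subr_gt0.
have ex : exists n, b ^+ n * c <= 2 * r.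
  have [||n bn] := @expr_small _ b (2 * r / c); first by rewrite (ltW b0)/=; case/andP: b01.
    by rewrite divr_gt0// mulr_gt0.
  by exists n; rewrite -ler_pdivlMr// ltW.
(* At level [n.-1] the gaps still exceed the diameter of the ball; this loss of
   one level accounts for the division by [b] in [K]. *)
have [n bn nmin] := ex_minnP ex.
have Kr : (b ^+ n / b) `^ s <= K * r `^ s.
  have -> : K * r `^ s = (2 / (b * c) * r) `^ s.
    by rewrite -powRM// ltW// ?divr_gt0// mulr_gt0.
  have le_r : b ^+ n / b <= 2 / (b * c) * r.
    rewrite ler_pdivrMr// (_ : _ * _ * b = 2 * r / c); first by rewrite ler_pdivlMr.
    by field; rewrite !gt_eqF.
  apply: ge0_ler_powR => //; rewrite ?nnegrE; first exact: ltW.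
    by rewrite ltW// divr_gt0// exprn_gt0.
  by rewrite ltW// mulr_gt0// divr_gt0// mulr_gt0.
case: n bn nmin Kr => [|n] bn nmin Kr.
  apply: (@le_trans _ _ 1).
    case/andP: t01; case/andP: u01 => *; rewrite ler_norml; apply/andP; split; lra.
  apply: le_trans Kr; rewrite expr0 mul1r.
  have -> : 1 = 1 `^ s :> R by rewrite powR1.
  apply: ge0_ler_powR; rewrite ?nnegrE ?invr_ge0 ?(ltW b0) ?(ltW s0)//.
  by rewrite invf_ge1// ltW//; case/andP: b01.
have tun : dyadic (d * n) t = dyadic (d * n) u.
  apply: contrapT => /(dust_separated t01 u01)[i]; rewrite -/c => ci.
  suff : b ^+ n * c <= 2 * r by move/nmin; rewrite ltnn.
  apply: (le_trans ci); have := xt i; have := xu i.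
  rewrite !ltr_norml ler_norml => /andP[? ?] /andP[? ?]; apply/andP; split; lra.
apply: le_trans (dyadic_dist t0 u0 tun) _; apply: le_trans Kr.
by rewrite exprS mulrC mulKf ?gt_eqF// powbn.
Qed.

(** The parameters sent into one ball lie in an interval of length at most
    [2 * K * r `^ s]. A cover with sum at most [1 / (4 * K)] would thus cover
    [0, 1[ by intervals of total length at most 1/2. *)
Lemma dust_not_hnull : ~ hnull s (dust @` `[0, 1[%classic).
Proof.
move=> nd; have e0 : 0 < (4 * K)^-1 by rewrite invr_gt0 mulr_gt0.
have [x [r [r0 dr sr]]] := nd _ e0.
pose T i := [set t | 0 <= t < 1 /\ ball (x i) (r i) (dust t)].
pose c i := xget 0 (T i).
pose h i := K * r i `^ s.
have h0 i : 0 <= h i by rewrite mulr_ge0 ?powR_ge0// ltW.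
have cover : `[0, 1[%classic `<=` \bigcup_i `[c i - h i, c i + h i]%classic.
  move=> t /= t01; have [i _ xit] := dr _ (imageP dust t01).
  move: t01; rewrite in_itv/= => t01.
  have [c01 xic] : T i (c i) by apply: xgetPex; exists t.
  exists i => //=; rewrite in_itv/=.
  have := dust_holder t01 c01 xit xic; rewrite ler_norml -/(h i) => /andP[? ?].
  by apply/andP; split; lra.
have : (lebesgue_measure (`[0%R, 1%R[%classic : set R) <=
    \sum_(0 <= i <oo) lebesgue_measure (`[(c i - h i)%R, (c i + h i)%R]%classic : set R))%E.
  by apply: measure_sigma_subadditive => // i; exact: measurable_itv.
apply/negP; rewrite -ltNge lebesgue_measure_itv/= lte_fin ltr01 sube0.
apply: (@le_lt_trans _ _ (2^-1)%:E); last by rewrite lte_fin invf_lt1// ltr1n.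
apply: lime_le; first by apply: is_cvg_nneseries => *; exact: measure_ge0.
apply: nearW => n.
apply: (@le_trans _ _ (\sum_(0 <= i < n) (2 * K * r i `^ s)%:E)%E).
  apply: lee_sum => i _; rewrite lebesgue_measure_itv/=.
  have hE : 2 * K * r i `^ s = h i + h i by rewrite /h; ring.
  case: ifPn => _; rewrite lee_fin hE; last exact: addr_ge0.
  by lra.
rewrite sumEFin lee_fin -mulr_sumr.
apply: le_trans (ler_wpM2l _ (sr n)) _; first by rewrite mulr_ge0// ltW.
by rewrite invfM mulrACA divff ?gt_eqF//; lra.
Qed.

(** An enumeration of the dyadic numbers of [0, 1[; codes of anything else
    give 0. *)
Definition dust_parameter (k : nat) : R :=
  let: (a, m) := odflt (0, 0)%N (unpickle k) in
  if (a < 2 ^ m)%N then a%:R / 2 ^+ m else 0.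

Lemma dust_parameter_itv k : 0 <= dust_parameter k < 1.
Proof.
rewrite /dust_parameter; case: (odflt _ _) => a m; case: ifPn => [am|_].
  exact: dyadic_frac_itv.
by rewrite lexx ltr01.
Qed.

Lemma dust_parameter_dense m (t : R) : 0 <= t < 1 ->
  exists k, dyadic m t = dyadic m (dust_parameter k).
Proof.
move=> t01; exists (pickle (dyadic m t, m)).
by rewrite /dust_parameter pickleK /= dyadic_lt// dyadic_frac.
Qed.

Definition dust_point k := dust (dust_parameter k).

Lemma dust_sub_closure : dust @` `[0, 1[%classic `<=` closure (range dust_point).
Proof.
move=> _ [t t_itv <-] B /nbhs_ballP[e /= e0 eB].
have t01 : 0 <= t < 1 by move: t_itv; rewrite /= in_itv.
have [||n bn] := @expr_small _ b (e / D); first by rewrite (ltW b0)/=; case/andP: b01.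
  by rewrite divr_gt0.
have [k tk] := dust_parameter_dense (d * n) t01.
exists (dust_point k); split; first by exists k.
apply: eB; apply/rV_ballP; split=> // j.
have /andP[t0 _] := t01; have /andP[p0 _] := dust_parameter_itv k.
apply: le_lt_trans (dust_close j t0 p0 tk) _.
by rewrite -ltr_pdivlMr.
Qed.

(** At level [n] the dust is covered by [2 ^ (d * n)] balls of radius
    comparable to [b ^+ n], and [2 ^+ (d * n) * (b ^+ n) `^ u] equals
    [(b `^ (u - s)) ^+ n], which tends to 0. *)
Lemma dust_hnull u : s < u -> hnull u (closure (range dust_point)).
Proof.
move=> su; have u0 : 0 < u := lt_trans s0 su.
apply: hnull_finite_cover => // eps eps0.
have z01 : 0 <= b `^ (u - s) < 1.
  rewrite powR_ge0/= -[ltRHS](_ : 1 `^ (u - s) = 1); last by rewrite powR1.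
  by apply: gt0_ltr_powR; rewrite ?nnegrE ?subr_gt0 ?(ltW b0)//; case/andP: b01.
have C0 : 0 < (2 * D) `^ u by rewrite powR_gt0// mulr_gt0.
have [|n zn] := expr_small z01 (e := eps / (2 * D) `^ u).
  by rewrite divr_gt0.
have bn0 : 0 < b ^+ n by exact: exprn_gt0.
exists (2 ^ (d * n))%N, (fun k => dust (k%:R / 2 ^+ (d * n))), (b ^+ n * (2 * D)); split.
- by rewrite !mulr_ge0// ltW.
- move=> y Ey.
  have [_ [[k _ <-] /rV_ballP[_ yk]]] := Ey _ (nbhsx_ballx y (b ^+ n * D) (mulr_gt0 bn0 D0)).
  have pk := dust_parameter_itv k.
  exists (dyadic (d * n) (dust_parameter k)); first exact: dyadic_lt.
  apply/rV_ballP; split=> [|j]; first by rewrite !mulr_gt0.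
  rewrite -(subrKA (dust_point k 0 j)); apply: le_lt_trans (ler_normD _ _) _.
  rewrite (_ : b ^+ n * (2 * D) = b ^+ n * D + b ^+ n * D); last by ring.
  apply: ler_ltD; last by rewrite distrC.
  apply: dust_close; rewrite ?dyadic_frac//; last by case/andP: pk.
- have D2 : 0 <= 2 * D by rewrite mulr_ge0// ltW.
  rewrite (powRM _ (ltW bn0) D2) mulrA -ler_pdivlMr//.
  apply: le_trans (ltW zn).
  have -> : (b ^+ n) `^ u = (2 ^+ (d * n))^-1 * (b ^+ n) `^ (u - s).
    by rewrite -powbn -powRD ?subrKC// gt_eqF ?implybT.
  rewrite natrX mulrA.
  rewrite divff ?expf_neq0// mul1r.
  rewrite -[X in X `^ _]powR_mulrn ?(ltW b0)// -[leRHS]powR_mulrn ?powR_ge0//.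
  by rewrite -!(powRrM b) mulrC.
Qed.

(** The translation by [v] will place the dusts far apart, and the lower bound
    on the coordinates records where they are. The sequence [g] provides finite
    approximations of the dust. *)
Lemma cantor_dust : exists g : nat -> 'rV[R]_d,
  [/\ forall k i, v 0 i <= g k 0 i,
      ~ hnull s (closure (range g)) &
      forall u, s < u -> hnull u (closure (range g))].
Proof.
exists dust_point; split => //.
- by move=> k i; exact: dust_ge.
- by move=> nd; apply: dust_not_hnull; apply: hnullS nd; exact: dust_sub_closure.
- by move=> u; exact: dust_hnull.
Qed.

End cantor_dust.

(** * Reductions from zero-dimensional Polish spaces *)

(** A clopen basis need not be countable, but the balls of radius
    [1 / n.+1] around a countable dense set are countably many: for each of them
    that fits into a clopen subset of [O], select one such subset. The selected
    sets exhaust [O]. *)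
Lemma clopen_open_exhaustion (R : realType) (X : topologicalType) (O : set X) :
  polish R X -> clopen_basis X -> open O ->
  exists C : nat -> set X, [/\ forall k, clopen (C k),
    forall j k, (j <= k)%N -> C j `<=` C k & \bigcup_k C k = O].
Proof.
move=> [[Q Qc Qd] [dist [[_ dist_sym dist_tri] nbhs_dist _]]] [B Bclopen [_ Bbasis]] oO.
pose ball_in (e : nat -> X) (p : nat * nat) U := [/\ clopen U, U `<=` O &
  forall y, dist (e p.1) y < p.2.+1%:R^-1 -> U y].
suff [c [cclopen cO Oc]] : exists c : nat -> set X,
    [/\ forall i, clopen (c i), forall i, c i `<=` O & O `<=` \bigcup_i c i].
  exists (fun k => \bigcup_(i in `I_k) c i); split.
  - move=> k; split; first by apply: bigcup_open => i _; have [] := cclopen i.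
    by apply: closed_bigcup => [|i _]; [exact: finite_II|have [] := cclopen i].
  - by move=> j k jk x [i /= ij cix]; exists i => //=; exact: leq_trans jk.
  - apply/seteqP; split=> [x [k _ [i _ /cO]]//|x /Oc[i _ cix]].
    by exists i.+1 => //; exists i => /=.
have [Q0|[e eQ]] : Q = set0 \/ exists e : nat -> X, Q `<=` range e.
  move: Qc => /pfcard_geP[->|/unsquash f]; [by left|right].
  by exists f => y /(@surj _ _ _ _ f)[n _ <-]; exists n.
  have O0 : O = set0.
    apply/eqP; apply: contrapT => /negP/set0P O0.
    by have [x []] := Qd _ O0 oO; rewrite Q0.
  by exists (fun=> set0); rewrite O0; split=> [_|_|]; [exact: clopen0|by []|by []].
pose c k := if @unpickle (nat * nat)%type k is Some p
  then xget set0 (ball_in e p) else set0.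
exists c; split.
- move=> k; rewrite /c; case: unpickle => [p|]; last exact: clopen0.
  by case: xgetP => [U _ []|_]//; exact: clopen0.
- move=> k; rewrite /c; case: unpickle => [p|]//.
  by case: xgetP => [U _ []|_].
- move=> x Ox.
  have [U [BU Ux] UO] := Bbasis x O (open_nbhs_nbhs (conj oO Ox)).
  have cU := Bclopen _ BU.
  have : nbhs x U by apply: open_nbhs_nbhs; split=> //; case: cU.
  rewrite nbhs_dist => -[eps /= eps0 epsU].
  have [n n_eps] : exists n, n.+1%:R^-1 < eps / 2.
    exists (Num.truncn (eps / 2)^-1).
    by rewrite invf_plt ?posrE ?divr_gt0//; exact: truncnS_gt.
  have : nbhs x [set y | dist x y < n.+1%:R^-1].
    by rewrite nbhs_dist; exists n.+1%:R^-1 => //=; rewrite invr_gt0.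
  rewrite nbhsE => -[V [oV Vx] VB].
  have [w [Vw Qw]] : V `&` Q !=set0 by apply: Qd => //; exists x.
  have [j _ ejw] := eQ w Qw.
  have /= xj := VB w Vw; rewrite -ejw in xj.
  have P : ball_in e (j, n) U.
    split=> // y /= jy; apply: epsU => /=.
    apply: le_lt_trans (dist_tri _ (e j) _) _; rewrite [ltRHS]splitr.
    by apply: ltrD; [exact: lt_trans n_eps|exact: lt_trans n_eps].
  exists (pickle (j, n)) => //; rewrite /c pickleK.
  case: xgetP => [W _ [_ _]|/(_ U)]//; apply => /=.
  by rewrite dist_sym.
Qed.

Lemma open_Sigma0_2 (R : realType) (X : topologicalType) (O : set X) :
  polish R X -> clopen_basis X -> open O -> Sigma0 2 O.
Proof.
move=> polX zX oO; have [C [Cc _ <-]] := clopen_open_exhaustion polX zX oO.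
by apply/Sigma0_2P; exists C => // k; case: (Cc k).
Qed.

(** In a zero-dimensional Polish space open sets are countable unions of
    clopen sets, so that all lower levels embed into Sigma_2. *)
Lemma Pi0_3_closed (R : realType) (X : topologicalType) (A : set X) :
  polish R X -> clopen_basis X -> Pi0 3 A ->
  exists G : nat -> nat -> set X,
    (forall i k, closed (G i k)) /\ A = \bigcap_i \bigcup_k G i k.
Proof.
move=> polX zX; rewrite /Pi0; move E : 3%N => n; move B : (~` A) => S H.
case: n S / H E B => [S _|n S F m n1 mn HF ->]; first by [].
move=> n3 AF; have F2 i : Sigma0 2 (~` F i).
  have := HF i; have := mn i; rewrite -n3.
  case: (m i) => [|[|[|k]]]//= _.
  by move=> /Sigma0_1_open; exact: (open_Sigma0_2 polX zX).
have /choice[G GP] : forall i, exists G : nat -> set X,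
    (forall k, closed (G k)) /\ ~` F i = \bigcup_k G k.
  by move=> i; have /Sigma0_2P[G] := F2 i; exists G.
exists G; split=> [i|]; first by have [] := GP i.
rewrite -[A]setCK AF setC_bigcup; apply: eq_bigcapr => i _.
by have [_ ->] := GP i.
Qed.

Section fell_reduction.
Variables (R : realType) (d : nat) (i0 : 'I_d) (X : topologicalType).
Variables (C : nat -> nat -> set X) (g : nat -> nat -> 'rV[R]_d).
Hypothesis clopenC : forall n k, clopen (C n k).
Hypothesis homoC : forall n j k, (j <= k)%N -> C n j `<=` C n k.
Hypothesis g_ge : forall n k, n%:R <= g n k 0 i0.

Let E n := closure (range (g n)).

(** As the sets [C n k] increase with [k], the stage is finite when [x] lies in
    one of them, and the whole sequence otherwise. *)
Definition stage n x : set 'rV[R]_d := [set g n k | k in [set k | ~ C n k x]].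

Definition reduction x : fell 'rV[R]_d :=
  ClosedSet (@closed_closure _ (\bigcup_n stage n x)).

Lemma stage_sub n x : stage n x `<=` range (g n).
Proof. by move=> _ [k _ <-]; exists k. Qed.

Lemma stage_full n x : (forall k, ~ C n k x) -> stage n x = range (g n).
Proof.
move=> nC; apply/seteqP; split; first exact: stage_sub.
by move=> _ [k _ <-]; exists k => //; exact: nC.
Qed.

Lemma stage_finite n k0 x : C n k0 x -> finite_set (stage n x).
Proof.
move=> Cx; apply: (@sub_finite_set _ _ (g n @` `I_k0)); last first.
  by apply: finite_image; exact: finite_II.
move=> _ [k nC <-]; exists k => //=; rewrite ltnNge; apply/negP => k0k.
by apply: nC; exact: homoC Cx.
Qed.

Lemma closure_stage_finite n k0 x : C n k0 x -> closure (stage n x) = stage n x.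
Proof.
move=> Cx; apply/esym/closure_id.
have /accessible_finite_set_closed : accessible_space 'rV[R]_d.
  by apply: hausdorff_accessible; exact: norm_hausdorff.
by apply; exact: stage_finite Cx.
Qed.

Lemma closure_range_ge n y : E n y -> n%:R <= y 0 i0.
Proof.
have cl : closed [set z : 'rV[R]_d | n%:R <= z 0 i0].
  apply: (@preimage_closed _ _ (fun z : 'rV[R]_d => z 0 i0) [set r | n%:R <= r]).
    by move=> z _; exact: coord_continuous.
  exact: closed_ge.
by move=> Ey; rewrite closure_id in cl; rewrite -/([set z : 'rV[R]_d | n%:R <= z 0 i0] y) cl;
  apply: closureS Ey => _ [k _ <-]; exact: g_ge.
Qed.

(** The [n]-th stage lies in the half-space of points whose coordinate [i0]
    is at least [n], so the family of stages is locally finite. *)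
Lemma reduction_pieces x :
  carrier (reduction x) = \bigcup_n closure (stage n x).
Proof.
apply/seteqP; split=> [y /= yx|y [n _]]; last first.
  by apply: closureS => z; exists n.
pose N := (Num.truncn (y 0 i0 + 1)).+1.
have yN : y 0 i0 + 1 < N%:R by exact: truncnS_gt.
have : \bigcup_n stage n x `<=`
    (\bigcup_(n in `I_N) stage n x) `|` [set z : 'rV[R]_d | N%:R <= z 0 i0].
  move=> z [n _ nz]; have [nN|Nn] := ltnP n N; first by left; exists n.
  right => /=; have [k _ <-] := nz; apply: le_trans (g_ge _ _).
  by rewrite ler_nat.
move=> /closureS/(_ y yx); rewrite closureU => -[|yfar]; last first.
  have [z [/= Nz /rV_ballP[_ /(_ i0)]]] := yfar _ (nbhsx_ballx y 1 ltr01).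
  by rewrite ltr_norml => /andP[? ?]; lra.
elim: N {yN} => [|N ih]; first by rewrite II0 bigcup_set0 closure0.
by rewrite IIS bigcup_setU bigcup_set1 closureU => -[|yN]; [exact: ih|exists N].
Qed.

(** If [K] does not meet the full [n]-th piece, no stage meets [K]. Otherwise
    a stage that misses [K] is not full, hence has only finitely many points, and
    it is controlled by finitely many of the clopen sets. *)
Lemma miss_stage_open n (K : set 'rV[R]_d) : 
  open [set x | closure (stage n x) `&` K = set0].
Proof.
set M := mkset _.
have [EK|EK] := pselect (E n `&` K = set0).
  rewrite (_ : M = setT); first exact: openT.
  apply/seteqP; split=> // x _; rewrite /M/= -subset0 -EK; apply: setSI.
  by apply: closureS; exact: stage_sub.
rewrite (_ : M = \bigcup_k0 (C n k0 `&`
    \bigcap_(k in [set k | (k < k0)%N /\ K (g n k)]) C n k)).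
  apply: bigcup_open => k0 _; apply: openI; first by case: (clopenC n k0).
  apply: open_bigcap_finite => [|k _]; last by case: (clopenC n k).
  by apply: (@sub_finite_set _ _ `I_k0) => [k []|]; [|exact: finite_II].
apply/seteqP; split=> x.
  move=> Mx; have [k0 Ck0] : exists k0, C n k0 x.
    apply: contrapT => /forallNP nC; apply: EK.
    by rewrite /E -(stage_full nC).
  exists k0 => //; split=> // k [_ Kk]; apply: contrapT => nCk.
  suff : (closure (stage n x) `&` K) (g n k) by rewrite Mx.
  by split=> //; apply: subset_closure; exists k.
move=> [k0 _ [Ck0 CK]]; rewrite /M/= (closure_stage_finite Ck0) -subset0.
move=> _ [[k nCk <-] Kk]; apply: (nCk); apply: CK; split => //=.
by rewrite ltnNge; apply/negP => k0k; apply: nCk; exact: homoC Ck0.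
Qed.

Lemma reduction_continuous : continuous reduction.
Proof.
apply: continuous_fell => [K cK|U oU].
  have [N KN] : exists N : nat, forall y, K y -> y 0 i0 < N%:R.
    have [M [_ /(_ (M + 1))]] := compact_bounded cK.
    rewrite ltrDl ltr01 => /(_ isT) KM.
    exists (Num.truncn (M + 1)).+1 => y /KM yM.
    apply: le_lt_trans (truncnS_gt (M + 1)).
    apply: le_trans yM; apply: le_trans (ler_norm _) _.
    rewrite [leRHS]mx_normrE; exact: (le_bigmax _ (fun ij => `|y ij.1 ij.2|) (0, i0)).
  rewrite (_ : _ @^-1` _ =
      \bigcap_(n in `I_N) [set x | closure (stage n x) `&` K = set0]).
    by apply: open_bigcap_finite => [|n _]; [exact: finite_II|exact: miss_stage_open].
  apply/seteqP; split=> x.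
    rewrite -[_ x]/(carrier (reduction x) `&` K = set0) reduction_pieces => xK n _.
    by rewrite /= -subset0 -xK; apply: setSI; exact: (@bigcup_sup _ _ n).
  move=> xK; rewrite -[_ x]/(carrier (reduction x) `&` K = set0) reduction_pieces.
  rewrite -subset0 => y [[n _ ny] Ky].
  have nN : (n < N)%N.
    rewrite -(ltr_nat R); apply: le_lt_trans (KN y Ky).
    by apply: closure_range_ge; apply: closureS ny; exact: stage_sub.
  by rewrite -(xK n nN).
rewrite (_ : _ @^-1` _ = \bigcup_(nk in [set nk : nat * nat | U (g nk.1 nk.2)]) ~` C nk.1 nk.2).
  apply: bigcup_open => -[n k] _; apply: closed_openC; by case: (clopenC n k).
apply/seteqP; split=> x.
  move=> [y [/= yx Uy]].
  have [_ [[n _ [k nC <-]] Uk]] := yx _ (open_nbhs_nbhs (conj oU Uy)).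
  by exists (n, k).
move=> [[n k] /= Uk nC]; exists (g n k); split=> //.
by apply: subset_closure; exists n => //; exists k.
Qed.

Lemma reduction_hnull x t : 0 < t ->
  hnull t (carrier (reduction x)) <->
  forall n, (forall k, ~ C n k x) -> hnull t (E n).
Proof.
move=> t0; rewrite reduction_pieces; split.
  move=> nx n nC; apply: hnullS nx; rewrite /E -(stage_full nC).
  exact: (@bigcup_sup _ _ n).
move=> nE; apply: hnull_bigcup => n.
have [[k0 Ck0]|/forallNP nC] := pselect (exists k0, C n k0 x).
  apply: hnull_countable => //; rewrite (closure_stage_finite Ck0).
  by apply: finite_set_countable; exact: stage_finite Ck0.
by rewrite (stage_full nC); exact: nE.
Qed.

End fell_reduction.

(** The closed sets [F n] and dimensions [sigma n] are arbitrary; this is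
    the common source of both hardness results. *)
Lemma dim_reduction (R : realType) (d : nat) (d_ge1 : (1 <= d)%N)
    (X : topologicalType) (F : nat -> set X) (sigma : nat -> R) :
  polish R X -> clopen_basis X -> (forall n, closed (F n)) ->
  (forall n, 0 < sigma n < d%:R) ->
  exists2 f : X -> fell 'rV[R]_d, continuous f & forall x a, 0 <= a ->
    (a%:E < hausdorff_dim (carrier (f x)))%E <-> exists2 n, F n x & a < sigma n.
Proof.
move=> polX zX Fc sd; pose i0 := Ordinal d_ge1.
have /choice[C CP] : forall n, exists C : nat -> set X, [/\ forall k, clopen (C k),
    forall j k, (j <= k)%N -> C j `<=` C k & \bigcup_k C k = ~` F n].
  by move=> n; apply: (clopen_open_exhaustion polX zX); exact: closed_openC.
have /choice[g gP] : forall n, exists g : nat -> 'rV[R]_d,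
    [/\ forall k i, (const_mx n%:R : 'rV[R]_d) 0 i <= g k 0 i,
        ~ hnull (sigma n) (closure (range g)) &
        forall u, sigma n < u -> hnull u (closure (range g))].
  by move=> n; exact: cantor_dust.
have FE n x : F n x <-> forall k, ~ C n k x.
  have [_ _ CF] := CP n; split=> [Fx k Ck|nC].
    have : (~` F n) x by rewrite -CF; exists k.
    exact.
  apply: contrapT => nF; have : (~` F n) x by [].
  by rewrite -CF => -[k _ /nC].
have clC n k : clopen (C n k) by have [] := CP n.
have homC n j k : (j <= k)%N -> C n j `<=` C n k by have [_ + _] := CP n; exact.
have g_ge n k : n%:R <= g n k 0 i0.
  by have [/(_ k i0)] := gP n; rewrite mxE.
exists (reduction C g); first exact: (@reduction_continuous _ _ i0).
move=> x a a0; rewrite (hausdorff_dim_gtP _ a0); split.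
  move=> [s ras]; rewrite (reduction_hnull homC g_ge _ (le_lt_trans a0 ras)).
  move=> /existsNP[n /not_implyP[/FE Fx nn]]; exists n => //.
  apply: (lt_le_trans ras); rewrite leNgt; apply/negP => sn.
  by apply: nn; have [_ _] := gP n; exact.
move=> [n /FE nC an]; exists (sigma n) => //.
rewrite (reduction_hnull homC g_ge _ (le_lt_trans a0 an)) => /(_ n nC).
by have [] := gP n.
Qed.

Lemma dim_gt_Sigma0_2_hard (R : realType) (d : nat) (p : R) : (1 <= d)%N ->
  0 <= p < d%:R ->
  hard R (fun T => @Sigma0 T 2)
    [set A : fell 'rV[R]_d | (p%:E < hausdorff_dim (carrier A))%E].
Proof.
move=> d_ge1 /andP[p0 pd] X polX zX A /Sigma0_2P[F Fc ->].
have [|f fc f_dim] := dim_reduction d_ge1 (sigma := fun=> (p + d%:R) / 2) polX zX Fc.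
  by move=> _; lra.
exists f => // x; rewrite /= f_dim//; split=> [[n _ Fx]|[n Fx _]]; exists n => //.
by lra.
Qed.

Section Pi3_hard.
Variables (R : realType) (d : nat) (q : R).
Hypothesis d_ge1 : (1 <= d)%N.
Hypothesis q0d : 0 < q <= d%:R.

Let q0 : 0 < q. Proof. by case/andP: q0d. Qed.

(** Any increasing sequence of dimensions in ]0, q[ that converges to [q]
    would do. *)
Definition target m : R := q * (1 - m.+2%:R^-1).

Let inv_gt0 m : 0 < m.+1%:R^-1 :> R. Proof. by rewrite invr_gt0. Qed.

Lemma target_lt m : target m < q.
Proof. by rewrite gtr_pMr// gtrBl inv_gt0. Qed.

Lemma target_gt0 m : 0 < target m.
Proof. by rewrite mulr_gt0// subr_gt0 invf_lt1// ltr1n. Qed.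

Lemma target_itv m : 0 < target m < d%:R.
Proof.
rewrite target_gt0 (lt_le_trans (target_lt m))//; by case/andP: q0d.
Qed.

Lemma target_mono m n : (target m < target n) = (m < n)%N.
Proof.
rewrite ltr_pM2l// ltrD2l ltrN2 ltf_pV2 ?posrE// ltr_nat.
by rewrite ltnS.
Qed.

Lemma target_cofinal (a : R) : a < q -> exists m, a < target m.
Proof.
move=> aq; have aq0 : 0 < 1 - a / q by rewrite subr_gt0 ltr_pdivrMr// mul1r.
exists (Num.truncn (1 - a / q)^-1).
rewrite -ltr_pdivrMl// mulrC ltrBrDl -ltrBrDr invf_plt ?posrE//.
by apply: lt_trans (truncnS_gt _) _; rewrite ltr_nat.
Qed.

Lemma le_dim_targets (A : set 'rV[R]_d) :
  (q%:E <= hausdorff_dim A)%E <-> forall m, ((target m)%:E < hausdorff_dim A)%E.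
Proof.
split=> [qA m|tA]; first by apply: lt_le_trans qA; rewrite lte_fin target_lt.
rewrite leNgt; apply/negP => Aq.
have : (0 <= hausdorff_dim A)%E by rewrite le_max lexx.
case AD : (hausdorff_dim A) => [D| |]// _; last by rewrite AD in Aq.
move: Aq; rewrite AD lte_fin => /target_cofinal[m Dm].
by have := tA m; rewrite AD lte_fin => /(lt_trans Dm); rewrite ltxx.
Qed.

(** Natural numbers [n] serve as codes of finite sequences [w n]; numbers that
    encode no sequence stand for the empty one, which does no harm as its dust
    has the least of the dimensions used here. *)
Lemma dim_ge_Pi0_3_hard :
  hard R (@Pi0 3) [set A : fell 'rV[R]_d | (q%:E <= hausdorff_dim (carrier A))%E].
Proof.
move=> X polX zX A A3.
have [G [Gc AG]] : exists G : nat -> nat -> set X,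
    (forall i k, closed (G i k)) /\ A = \bigcap_i \bigcup_k G i k.
  exact: (Pi0_3_closed polX zX).
pose w n : seq nat := odflt [::] (unpickle n).
have w_pickle u : w (pickle u) = u by rewrite /w pickleK.
pose F n := \bigcap_(i in `I_(size (w n))) G i (nth 0%N (w n) i).
have Fc n : closed (F n) by apply: closed_bigI => i _; exact: Gc.
have [|f fc f_dim] := dim_reduction d_ge1 (sigma := fun n => target (size (w n))) polX zX Fc.
  by move=> n; exact: target_itv.
exists f => // x; rewrite /= le_dim_targets AG; split=> [Ax m|tx i _].
  apply/f_dim; first exact/ltW/target_gt0.
  have /choice[k xk] : forall i, exists k, G i k x.
    by move=> i; have [k _ Gx] := Ax i I; exists k.
  exists (pickle (mkseq k m.+1)).
    by rewrite /F w_pickle size_mkseq => i im; rewrite nth_mkseq.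
  by rewrite w_pickle size_mkseq target_mono.
have /f_dim := tx i; move=> /(_ (ltW (target_gt0 i)))[n Fx].
rewrite target_mono => iw; exists (nth 0%N (w n) i) => //.
exact: Fx.
Qed.

End Pi3_hard.

Theorem theorem5p4 (R : realType) (d : nat) (d_ge1 : (1 <= d)%N) :
  [/\ Sigma0 2 [set Ap : (upper_fell 'rV[R]_d * `[0, d%:R : R]%classic)%type |
                 ((set_val Ap.2)%:E < hausdorff_dim (carrier Ap.1))%E],
      Pi0 3 [set Ap : (upper_fell 'rV[R]_d * `[0, d%:R : R]%classic)%type |
                 ((set_val Ap.2)%:E <= hausdorff_dim (carrier Ap.1))%E],
      forall p : R, 0 <= p < d%:R ->
        complete_for R (fun T => @Sigma0 T 2)
          [set A : fell 'rV[R]_d | (p%:E < hausdorff_dim (carrier A))%E] &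
      forall q : R, 0 < q <= d%:R ->
        complete_for R (@Pi0 3)
          [set A : fell 'rV[R]_d | (q%:E <= hausdorff_dim (carrier A))%E]].
Proof.
have X1 := @Sigma0_2_dim_gt_param R d; have X2 := @Pi0_3_dim_ge_param R d.
split => // [p pd|q qd].
- split; first exact: dim_gt_Sigma0_2_hard.
  have pI : p \in `[0, d%:R]%classic.
    by rewrite inE/= in_itv/=; case/andP: pd => -> /ltW.
  have := Sigma0_preimage (@fell_slice_continuous R d (exist _ p pI)) X1.
  by rewrite /preimage set_valE.
- split; first exact: dim_ge_Pi0_3_hard.
  have qI : q \in `[0, d%:R]%classic.
    by rewrite inE/= in_itv/=; case/andP: qd => /ltW -> ->.
  have := Sigma0_preimage (@fell_slice_continuous R d (exist _ q qI)) X2.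
  by rewrite /Pi0 /preimage set_valE.
Qed.
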